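(* Let $n\ge 2$ be an integer and let $\mathbb{Z}_n$ be the cyclic group of order $n$. Then $$\omega(\mathcal{R}_{\mathbb{Z}_n})=\sigma_n.$$
   Context: The power graph $\Gamma_G$ of a finite group $G$ has vertex set $G$, and two distinct elements are adjacent if one is a power of the other. For a graph $\Gamma$, $N_\Gamma[x]$ denotes the closed neighborhood of a vertex $x$ (that is, $x$ together with all vertices adjacent to $x$). Define $x\equiv y$ if $N_\Gamma[x]=N_\Gamma[y]$; this is an equivalence relation. Let $U(\Gamma)$ be a complete set of distinct representatives of its classes. The reduced graph $\mathcal{R}_\Gamma$ has vertex set $U(\Gamma)$, and two vertices are adjacent if they are adjacent in $\Gamma$. For a finite group $G$, $\mathcal{R}_G$ denotes the reduced graph $\mathcal{R}_{\Gamma_G}$ of its power graph. The clique number $\omega(\Gamma)$ is the maximum cardinality of a set of pairwise adjacent vertices. For $n=p_1^{r_1}p_2^{r_2}\cdots p_m^{r_m}$ with $p_1,\dots,p_m$ distinct primes, $m\ge 1$ and all $r_i\ge 1$, set $\sigma_n=1$ if $m=1$, and $\sigma_n=\sum_{i=1}^m r_i$ if $m\ge 2$. *)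

(* Defs.v *)
From HB Require Import structures.
From mathcomp Require Import all_boot all_order all_algebra all_fingroup.

Set Implicit Arguments.
Unset Strict Implicit.
Unset Printing Implicit Defensive.

Record sgraph := SGraph {
  vertex :> finType;
  adj : rel vertex;
  adj_sym : symmetric adj;
  adj_irr : irreflexive adj }.

Section Graphs.
Variable Gamma : sgraph.

Definition closed_nbhd (x : Gamma) : {set Gamma} :=
  [set y | (y == x) || adj x y].

Definition nbhd_equiv : rel Gamma :=
  fun x y => closed_nbhd x == closed_nbhd y.

Definition nbhd_classes : {set {set Gamma}} :=
  equivalence_partition nbhd_equiv [set: Gamma].

Definition is_clique (A : {set Gamma}) : bool :=
  [forall x in A, forall y in A, (x != y) ==> adj x y].

Definition clique_number : nat := \max_(A : {set Gamma} | is_clique A) #|A|.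

Variable U : {set Gamma}.

Definition induced_adj : rel {x : Gamma | x \in U} :=
  fun x y => adj (val x) (val y).

Lemma induced_adj_sym : symmetric induced_adj.
Proof. by move=> x y; exact: adj_sym. Qed.

Lemma induced_adj_irr : irreflexive induced_adj.
Proof. by move=> x; exact: adj_irr. Qed.

Definition induced_subgraph : sgraph := SGraph induced_adj_sym induced_adj_irr.

Definition is_class_representatives : bool :=
  is_transversal U nbhd_classes [set: Gamma].

(* Meaningful when is_class_representatives holds; see
   class_representatives_exist. *)
Definition reduced_graph : sgraph := induced_subgraph.

End Graphs.

Lemma nbhd_equiv_equivalence (Gamma : sgraph) :
  {in [set: Gamma] & &, equivalence_rel (@nbhd_equiv Gamma)}.
Proof.
move=> x y z _ _ _; rewrite /nbhd_equiv eqxx; split=> //.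
by move=> /eqP ->.
Qed.

Lemma class_representatives_exist (Gamma : sgraph) :
  exists U : {set Gamma}, is_class_representatives U.
Proof.
exists (transversal (nbhd_classes Gamma) [set: Gamma]); apply: transversalP.
exact: equivalence_partitionP (@nbhd_equiv_equivalence Gamma).
Qed.

Section PowerGraph.
Variable G : finGroupType.

Definition power_adj : rel G :=
  fun x y => (x != y) && ((x \in <[y]>%g) || (y \in <[x]>%g)).

Lemma power_adjP (x y : G) :
  reflect (x <> y /\ ((exists k, x = (y ^+ k)%g) \/ (exists k, y = (x ^+ k)%g)))
          (power_adj x y).
Proof.
apply: (iffP andP) => [[/eqP nxy /orP xy] | [nxy xy]]; split=> //.
- by case: xy => /cycleP; [left | right].
- exact/eqP.
- by apply/orP; case: xy => /cycleP; [left | right].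
Qed.

Lemma power_adj_sym : symmetric power_adj.
Proof. by move=> x y; rewrite /power_adj eq_sym orbC. Qed.

Lemma power_adj_irr : irreflexive power_adj.
Proof. by move=> x; rewrite /power_adj eqxx. Qed.

Definition power_graph : sgraph := SGraph power_adj_sym power_adj_irr.

End PowerGraph.

(* Intended for 1 < n, so that size (primes n) is positive. *)
Definition sigma (n : nat) : nat :=
  if size (primes n) == 1 then 1 else \sum_(p <- primes n) logn p n.

(* Main.v *)
Require Import Defs.
From HB Require Import structures.
From mathcomp Require Import all_boot all_order all_algebra all_fingroup.
From mathcomp Require Import cyclic.

(** In a cyclic group of order n, one element is a power of another exactly
    when its order divides the order of the other.  So the power graph only
    sees orders: x lies in the closed neighbourhood of y if and only if #[x]
    and #[y] are comparable for divisibility, and every divisor of n is the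
    order of some element.  A clique of the reduced graph is therefore a chain
    of divisors of n, counted up to equality of neighbourhoods.

    Write Omega n for the number of prime factors of n with multiplicity.  A
    maximal chain from 1 to n has Omega n + 1 terms, but 1 and n are both
    comparable to every divisor and so have the same neighbourhood; this is
    what brings the number down to Omega n.

    Upper bound: along a chain of divisors Omega is injective, so Omega of the
    order, taken modulo Omega n, separates adjacent elements unless their orders
    are equal or are 1 and n; in both cases the elements are equivalent
    ([clique_number_reduced_power_le]).

    Lower bound: take a maximal chain of proper divisors of n.  When n has two
    distinct prime factors, any two of its terms d | e are told apart by some
    divisor of n comparable to exactly one of them
    ([exists_separating_divisor]).

    When n is a prime power all divisors are comparable, the power graph is
    complete and the reduced graph has a single vertex. *)

Set Implicit Arguments.
Unset Strict Implicit.
Unset Printing Implicit Defensive.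

(** * Cliques of reduced graphs *)

Section ReducedGraph.
Variables (Gamma : sgraph) (U : {set Gamma}).
Hypothesis hU : is_class_representatives U.

Lemma class_representative_exists (x : Gamma) :
  exists2 u, u \in U & nbhd_equiv x u.
Proof.
have /and3P[/eqP cov _ _] := equivalence_partitionP (@nbhd_equiv_equivalence Gamma).
have Px : pblock (nbhd_classes Gamma) x \in nbhd_classes Gamma.
  by rewrite pblock_mem // cov inE.
have: pblock (nbhd_classes Gamma) x \in [set pblock (nbhd_classes Gamma) u | u in U].
  by rewrite (pblock_transversal hU).
case/imsetP=> u uU eq_xu; exists u => //.
rewrite -(pblock_equivalence_partition (@nbhd_equiv_equivalence Gamma)) ?inE //.
by rewrite -/(nbhd_classes Gamma) eq_xu mem_pblock cov inE.
Qed.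

Lemma class_representative_unique (u v : Gamma) :
  u \in U -> v \in U -> nbhd_equiv u v -> u = v.
Proof.
have eqR := @nbhd_equiv_equivalence Gamma.
have /and3P[/eqP _ triv _] := equivalence_partitionP eqR.
move=> uU vU Ruv; apply: (pblock_inj hU) => //; apply/esym/same_pblock => //.
by rewrite pblock_equivalence_partition ?inE.
Qed.

(** Distinct vertices of a clique are adjacent and inequivalent, so [phi] is
    injective on it. *)
Lemma clique_number_reduced_le k (phi : Gamma -> 'I_k) :
  (forall x y, adj x y -> phi x = phi y -> nbhd_equiv x y) ->
  clique_number (reduced_graph U) <= k.
Proof.
move=> phiP; apply/bigmax_leqP=> A /forall_inP clA.
rewrite -[k in _ <= k]card_ord -(@card_in_imset _ _ (phi \o val) A) ?max_card //.
move=> x y xA yA /= eq_phi; apply/eqP; apply: contraT => neq_xy.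
have adj_xy : adj (val x) (val y).
  by have /forall_inP/(_ y yA)/implyP/(_ neq_xy) := clA x xA.
case/eqP: neq_xy; apply: val_inj.
by apply: class_representative_unique (phiP _ _ adj_xy eq_phi); apply: valP.
Qed.

(** Replacing vertices by their representatives preserves adjacency, since
    adjacency only depends on closed neighbourhoods. *)
Lemma clique_number_reduced_ge (s : seq Gamma) :
  uniq s ->
  {in s &, forall x y, y \in closed_nbhd x} ->
  {in s &, forall x y, nbhd_equiv x y -> x = y} ->
  size s <= clique_number (reduced_graph U).
Proof.
move=> uniq_s clique_s sep_s.
have rep x : exists u : reduced_graph U, nbhd_equiv x (val u).
  by have [u uU xu] := class_representative_exists x; exists (Sub u uU).
pose f x := xchoose (rep x); have fP x : nbhd_equiv x (val (f x)) := xchooseP (rep x).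
have symN (x y : Gamma) : (y \in closed_nbhd x) = (x \in closed_nbhd y).
  by rewrite !inE eq_sym adj_sym.
have f_inj : {in s &, injective f}.
  move=> x y xs ys eq_f; apply: sep_s => //.
  by rewrite /nbhd_equiv (eqP (fP x)) (eqP (fP y)) eq_f.
have card_fs : #|[set u in map f s]| = size s.
  by rewrite cardsE (card_uniqP _) ?size_map // map_inj_in_uniq.
rewrite -card_fs /clique_number; apply: (bigmax_sup [set u in map f s]) => //.
apply/forall_inP=> _ /[!inE] /mapP[x xs ->].
apply/forall_inP=> _ /[!inE] /mapP[y ys ->]; apply/implyP=> neq_f.
have: val (f y) \in closed_nbhd (val (f x)).
  by rewrite -(eqP (fP x)) symN -(eqP (fP y)) clique_s.
by rewrite inE val_eqE eq_sym (negbTE neq_f).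
Qed.

End ReducedGraph.

(** * Chains of divisors *)

Definition dvd_comparable (d e : nat) : bool := (d %| e) || (e %| d).

Definition Omega (n : nat) : nat := \sum_(p <- primes n) logn p n.

Lemma OmegaM m n : 0 < m -> 0 < n -> Omega (m * n) = Omega m + Omega n.
Proof.
move=> m_gt0 n_gt0; pose s := primes (m * n).
(* Extending the range of summation to a common list s adds only zero terms. *)
have sumE k : 0 < k -> k %| m * n -> Omega k = \sum_(p <- s) logn p k.
  move=> k_gt0 k_dvd; rewrite [RHS](bigID (mem (primes k))) /=.
  rewrite [X in _ + X]big1 => [|p]; last by rewrite -logn_gt0 lt0n negbK => /eqP.
  rewrite addn0 -[RHS]big_filter; apply: perm_big; apply: uniq_perm.
  - exact: primes_uniq.
  - exact/filter_uniq/primes_uniq.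
  move=> p; rewrite mem_filter; case: (boolP (p \in primes k)) => //=.
  rewrite !mem_primes muln_gt0 m_gt0 n_gt0 => /and3P[-> _ p_dvd] /=.
  by rewrite (dvdn_trans p_dvd).
rewrite (sumE (m * n)) ?muln_gt0 ?m_gt0 // (sumE m) ?dvdn_mulr //.
rewrite (sumE n) ?dvdn_mull // -big_split /=.
by apply: eq_bigr => p _; rewrite lognM.
Qed.

Lemma Omega_eq0 n : 0 < n -> Omega n = 0 -> n = 1.
Proof.
move=> n_gt0 /eqP; rewrite /Omega sum_nat_seq_eq0 => /allP no_primes.
apply/eqP; apply: contraT => n_neq1.
have n_gt1 : 1 < n by rewrite ltn_neqAle eq_sym n_neq1.
have pn : pdiv n \in primes n by rewrite mem_primes pdiv_prime ?n_gt0 ?pdiv_dvd.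
by have := no_primes _ pn; rewrite -leqn0 leqNgt logn_gt0 pn.
Qed.

Lemma dvdn_Omega_eq d e : 0 < e -> d %| e -> Omega d = Omega e -> d = e.
Proof.
move=> e_gt0 /dvdnP[k def_e]; move: e_gt0; rewrite {}def_e muln_gt0.
case/andP=> k_gt0 d_gt0; rewrite OmegaM // => eqO.
by rewrite (@Omega_eq0 k) ?mul1n //; apply/eqP; rewrite -(eqn_add2r (Omega d)) -eqO.
Qed.

Lemma dvdn_leq_Omega d e : 0 < e -> d %| e -> Omega d <= Omega e.
Proof.
move=> e_gt0 /dvdnP[k def_e]; move: e_gt0; rewrite {}def_e muln_gt0.
by case/andP=> k_gt0 d_gt0; rewrite OmegaM // leq_addl.
Qed.

Lemma Omega_prime p : prime p -> Omega p = 1.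
Proof. by move=> p_pr; rewrite /Omega primes_prime // big_seq1 logn_prime ?eqxx. Qed.

(** If p is a prime factor of n, adding n / p to a maximal chain of proper
    divisors of n / p gives one for n. *)
Lemma proper_divisor_chain n : 0 < n ->
  exists s : seq nat, [/\ size s = Omega n, uniq s,
    {in s, forall d, d %| n /\ d != n} & {in s &, forall d e, dvd_comparable d e}].
Proof.
elim/ltn_ind: n => n IHn n_gt0.
have [n_le1 | n_gt1] := leqP n 1.
  have -> : n = 1 by apply/eqP; rewrite eqn_leq n_le1.
  by exists [::]; rewrite /Omega big_nil.
have p_pr := pdiv_prime n_gt1; set p := pdiv n in p_pr.
have def_n : n = p * (n %/ p) by rewrite mulnC divnK ?pdiv_dvd.
have m_lt : n %/ p < n by rewrite ltn_Pdiv ?prime_gt1.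
have m_gt0 : 0 < n %/ p by move: n_gt0; rewrite {1}def_n muln_gt0 => /andP[].
have m_dvd : n %/ p %| n by rewrite {2}def_n dvdn_mull.
have [s [size_s uniq_s div_s cmp_s]] := IHn _ m_lt m_gt0.
exists (n %/ p :: s); split.
- by rewrite [in RHS]def_n (OmegaM (prime_gt0 p_pr)) // Omega_prime // -size_s.
- by rewrite /= uniq_s andbT; apply/negP => /div_s[_ /eqP].
- move=> d; rewrite inE => /predU1P[-> | /div_s[d_dvd _]].
    by rewrite m_dvd neq_ltn m_lt.
  split; first exact: dvdn_trans d_dvd m_dvd.
  by rewrite neq_ltn (leq_ltn_trans (dvdn_leq m_gt0 d_dvd)).
- move=> d e; rewrite !inE /dvd_comparable.
  case/predU1P=> [-> | ds] /predU1P[-> | es]; rewrite ?dvdnn //.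
  + by have [-> _] := div_s _ es; rewrite orbT.
  + by have [-> _] := div_s _ ds.
  + exact: cmp_s.
Qed.

(** * Telling divisors apart by comparability *)

Lemma another_prime n p : 1 < n -> size (primes n) != 1 ->
  exists q, [/\ prime q, q %| n & q != p].
Proof.
move=> n_gt1 not1.
suff /hasP[q qn q_neq_p] : has (predC1 p) (primes n).
  by exists q; move: qn; rewrite mem_primes => /and3P[].
apply: contraR not1; rewrite has_predC negbK => /all_pred1P def_s.
have pn : pdiv n \in primes n by rewrite mem_primes pdiv_prime ?pdiv_dvd ?(ltnW n_gt1).
move: pn (primes_uniq n); rewrite def_s.
by case: (size (primes n)) => [|[|k]] //= _; rewrite inE eqxx.
Qed.

(** If d = 1, it is comparable to everything, and the point is to find a
    divisor of n incomparable to e.  For a prime p dividing n / e, the p-part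
    of n does not divide e; it is incomparable to e unless e is a power of p,
    and then any other prime q dividing n is.  If d > 1, the p'-part or the p-part of e,
    for a prime p dividing d, divides e and is incomparable to d, unless d and
    e are powers of p; then d q works for any other prime q dividing n. *)
Lemma exists_separating_divisor n d e :
    1 < n -> size (primes n) != 1 -> d %| e -> e %| n -> d != e -> e != n ->
  exists2 f, f %| n & dvd_comparable d f != dvd_comparable e f.
Proof.
rewrite /dvd_comparable => n_gt1 not1 d_e e_n d_neq_e e_neq_n.
have n_gt0 := ltnW n_gt1; have e_gt0 := dvdn_gt0 n_gt0 e_n.
have d_gt0 := dvdn_gt0 e_gt0 d_e.
have nat_dvd p q k : prime q -> q != p -> p.-nat k -> ~~ (q %| k).
  move=> q_pr q_neq_p /andP[k_gt0 /allP p_k]; apply: contra q_neq_p => q_k.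
  by apply: (p_k q); rewrite mem_primes q_pr k_gt0.
have [d1 | d_neq1] := eqVneq d 1.
  suff [f f_n ef] : exists2 f, f %| n & ~~ ((e %| f) || (f %| e)).
    by exists f; rewrite // (negbTE ef) d1 dvd1n.
  have /dvdnP[k def_n] := e_n.
  have k_gt1 : 1 < k.
    case: k def_n => [|[|k]] // def_n; first by rewrite def_n in n_gt0.
    by rewrite def_n mul1n eqxx in e_neq_n.
  pose p := pdiv k; have p_pr : prime p := pdiv_prime k_gt1.
  have np_e : ~~ (n`_p %| e).
    rewrite p_part pfactor_dvdn // def_n lognM ?(ltnW k_gt1) // -ltnNge.
    rewrite -[X in X < _]add0n ltn_add2r logn_gt0 mem_primes p_pr pdiv_dvd.
    by rewrite ltnW.
  have [e_np | e_np] := boolP (e %| n`_p); last first.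
    by exists n`_p; rewrite ?dvdn_part // negb_or e_np.
  have e_p : p.-nat e := pnat_dvd e_np (part_pnat p n).
  have [q [q_pr q_n q_neq_p]] := another_prime p n_gt1 not1.
  have q_e := nat_dvd _ _ _ q_pr q_neq_p e_p.
  exists q; rewrite // negb_or q_e andbT; apply: contra q_e => e_q.
  have /primeP[_ /(_ _ e_q)/orP[/eqP e1 | /eqP->//]] := q_pr.
  by rewrite d1 e1 eqxx in d_neq_e.
have d_gt1 : 1 < d by rewrite ltn_neqAle eq_sym d_neq1.
pose p := pdiv d; have p_pr : prime p := pdiv_prime d_gt1.
have p_d : p %| d := pdiv_dvd d.
have d_ep' : ~~ (d %| e`_p^').
  apply/negP=> /(dvdn_trans p_d) p_ep'.
  have /andP[_ /allP/(_ p)] := part_pnat p^' e.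
  by rewrite mem_primes p_pr part_gt0 p_ep' !inE eqxx => /(_ isT).
have [ep'_d | ep'_d] := boolP (e`_p^' %| d); last first.
  exists e`_p^'; first exact: dvdn_trans (dvdn_part _ _) e_n.
  by rewrite (negbTE d_ep') (negbTE ep'_d) dvdn_part orbT.
have e_d : ~~ (e %| d).
  by apply: contra d_neq_e => e_d; rewrite eqn_dvd d_e.
have ep_d : ~~ (e`_p %| d).
  apply: contra e_d => ep_d; rewrite -(partnC p e_gt0) Gauss_dvd ?ep_d //.
  exact: coprime_partC.
have [d_ep | d_ep] := boolP (d %| e`_p); last first.
  exists e`_p; first exact: dvdn_trans (dvdn_part _ _) e_n.
  by rewrite (negbTE d_ep) (negbTE ep_d) dvdn_part orbT.
have d_p : p.-nat d := pnat_dvd d_ep (part_pnat p e).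
have e_p : p.-nat e.
  rewrite -(partnC p e_gt0) pnatM part_pnat; exact: pnat_dvd ep'_d d_p.
have [q [q_pr q_n q_neq_p]] := another_prime p n_gt1 not1.
have q_d := nat_dvd _ _ _ q_pr q_neq_p d_p.
have q_e := nat_dvd _ _ _ q_pr q_neq_p e_p.
have co_e : coprime e q by rewrite coprime_sym prime_coprime.
exists (d * q).
  by rewrite Gauss_dvd ?(dvdn_trans d_e) // coprime_sym prime_coprime.
rewrite dvdn_mulr // Gauss_dvdl // (negbTE e_d) /=.
by apply/negP=> /eqP/esym dq_e; rewrite (dvdn_trans (dvdn_mull d (dvdnn q)) dq_e) in q_e.
Qed.

(** * Power graphs of cyclic groups *)

Section CyclicPowerGraph.
Variable gT : finGroupType.
Hypothesis cyc_gT : cyclic [set: gT].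

Local Notation n := #|[set: gT]|.

(** A cyclic group has a single subgroup of each order dividing its own. *)
Lemma mem_cycle_order (x y : gT) : (x \in <[y]>%g) = (#[x]%g %| #[y]%g).
Proof. by rewrite -cycle_subG -(cardSg_cyclic cyc_gT) ?subsetT. Qed.

Lemma order_dvd_card (x : gT) : #[x]%g %| n.
Proof. by rewrite order_dvdG ?inE. Qed.

Lemma exists_order d : d %| n -> exists x : gT, #[x]%g == d.
Proof.
have /cyclicP[g def_g] := cyc_gT; rewrite def_g -/(#[g]%g) => d_dvd.
by exists (g ^+ (#[g] %/ d))%g; rewrite orderXdiv ?dvdn_div // divnA // mulKn.
Qed.

Lemma mem_closed_nbhd_power (x y : power_graph gT) :
  (y \in closed_nbhd x) = dvd_comparable #[x : gT]%g #[y : gT]%g.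
Proof.
rewrite inE /= /power_adj !mem_cycle_order [x == y]eq_sym /dvd_comparable.
by have [-> | _] := eqVneq y x; rewrite ?dvdnn.
Qed.

(** The orders of the elements are exactly the divisors of n, so equality of
    neighbourhoods can be tested on divisors. *)
Lemma nbhd_equiv_powerP (x y : power_graph gT) :
  reflect (forall d, d %| n ->
             dvd_comparable #[x : gT]%g d = dvd_comparable #[y : gT]%g d)
          (nbhd_equiv x y).
Proof.
apply: (iffP eqP) => [eqN d /exists_order[z /eqP <-] | eqC].
  by rewrite -!mem_closed_nbhd_power eqN.
by apply/setP=> z; rewrite !mem_closed_nbhd_power eqC ?order_dvd_card.
Qed.

Variable U : {set power_graph gT}.
Hypothesis hU : is_class_representatives U.

Lemma clique_number_reduced_power_le :
  1 < n -> clique_number (reduced_graph U) <= Omega n.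
Proof.
move=> n_gt1; have n_gt0 := ltnW n_gt1.
have r_gt0 : 0 < Omega n.
  rewrite lt0n; apply/eqP => /(Omega_eq0 n_gt0) n1; by rewrite n1 in n_gt1.
pose phi (x : power_graph gT) : 'I_(Omega n) :=
  Ordinal (ltn_pmod (Omega #[x : gT]%g) r_gt0).
have dvd_equiv (x y : power_graph gT) : #[x : gT]%g %| #[y : gT]%g ->
    phi x = phi y -> nbhd_equiv x y.
  move=> x_y /(congr1 val) /= eq_mod; apply/nbhd_equiv_powerP=> d d_n.
  have y_n := order_dvd_card y; have y_gt0 := order_gt0 (y : gT).
  have le_xy := dvdn_leq_Omega y_gt0 x_y.
  have := dvdn_leq_Omega n_gt0 y_n; rewrite leq_eqVlt.
  case/predU1P=> [Oy | lt_y]; last first.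
    rewrite !modn_small // in eq_mod; last exact: leq_ltn_trans le_xy lt_y.
    by rewrite (dvdn_Omega_eq y_gt0 x_y eq_mod).
  (* y has order n, so x has order 1 or n *)
  move: eq_mod le_xy; rewrite (dvdn_Omega_eq n_gt0 y_n Oy) modnn => mod0.
  rewrite leq_eqVlt => /predU1P[Ox | lt_x].
    by rewrite (dvdn_Omega_eq n_gt0 (order_dvd_card x) Ox).
  rewrite modn_small // in mod0; rewrite (Omega_eq0 (order_gt0 _) mod0).
  by rewrite /dvd_comparable dvd1n d_n orbT.
apply: (clique_number_reduced_le hU (phi := phi)) => x y /andP[_].
rewrite !mem_cycle_order => /orP[] x_y eq_phi; first exact: dvd_equiv.
by rewrite /nbhd_equiv eq_sym; apply: dvd_equiv.
Qed.

Lemma clique_number_reduced_power_ge :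
  1 < n -> size (primes n) != 1 -> Omega n <= clique_number (reduced_graph U).
Proof.
move=> n_gt1 not1.
have [s [<- uniq_s div_s cmp_s]] := proper_divisor_chain (ltnW n_gt1).
pose g d : power_graph gT := odflt 1%g [pick x : gT | #[x]%g == d].
have gP d : d \in s -> #[g d : gT]%g = d.
  case/div_s=> /exists_order[x ox] _; rewrite /g.
  by case: pickP => [z /eqP // | /(_ x)]; rewrite ox.
rewrite -(size_map g); apply: (clique_number_reduced_ge hU).
- by rewrite map_inj_in_uniq // => d e ds es eq_g; rewrite -(gP d) // eq_g gP.
- move=> _ _ /mapP[d ds ->] /mapP[e es ->].
  by rewrite mem_closed_nbhd_power !gP // cmp_s.
have dvd_sep d e : d \in s -> e \in s -> d %| e -> nbhd_equiv (g d) (g e) -> d = e.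
  move=> ds es d_e /nbhd_equiv_powerP; rewrite !gP // => eqC.
  have [e_n e_neq_n] := div_s _ es.
  apply/eqP; apply: contraT => d_neq_e.
  have [f f_n] := exists_separating_divisor n_gt1 not1 d_e e_n d_neq_e e_neq_n.
  by rewrite eqC // eqxx.
move=> _ _ /mapP[d ds ->] /mapP[e es ->] eqN; congr g.
have /orP[d_e | e_d] := cmp_s d e ds es; first exact: dvd_sep.
by apply/esym/dvd_sep; rewrite // /nbhd_equiv eq_sym.
Qed.

(** The divisors of a prime power form a chain, so all vertices are
    equivalent. *)
Lemma clique_number_reduced_power_primary :
  size (primes n) == 1 -> clique_number (reduced_graph U) = 1.
Proof.
case def_p: (primes n) => [|p [|q t]] //= _.
have n_gt0 : 0 < n := cardG_gt0 _.
have : p \in primes n by rewrite def_p mem_head.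
rewrite mem_primes => /and3P[p_pr _ _].
have n_p : p.-nat n by rewrite /pnat n_gt0 def_p /= inE eqxx.
have cmp d e : d %| n -> e %| n -> dvd_comparable d e.
  move=> /pnat_dvd/(_ n_p)/p_natP[a ->] /pnat_dvd/(_ n_p)/p_natP[b ->].
  by rewrite /dvd_comparable !dvdn_Pexp2l ?prime_gt1 ?leq_total.
apply/eqP; rewrite eqn_leq; apply/andP; split.
  apply: (clique_number_reduced_le hU (phi := fun=> ord0)) => x y _ _.
  by apply/nbhd_equiv_powerP=> d d_n; rewrite !cmp ?order_dvd_card.
rewrite -[1]/(size [:: (1%g : power_graph gT)]).
apply: (clique_number_reduced_ge hU) => // x y; rewrite !inE => /eqP-> /eqP-> //.
by rewrite eqxx.
Qed.

Lemma clique_number_reduced_power :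
  1 < n -> clique_number (reduced_graph U) = sigma n.
Proof.
move=> n_gt1; rewrite /sigma.
have [/clique_number_reduced_power_primary // | not1] := ifPn.
apply/eqP; rewrite eqn_leq clique_number_reduced_power_le //.
exact: clique_number_reduced_power_ge.
Qed.

End CyclicPowerGraph.

(* The finGroupType structure on 'Z_n is its additive group. The claim is made
   for every choice U of class representatives. *)
Theorem theorem3p1 (n : nat) (hn : 1 < n) (U : {set power_graph 'Z_n})
    (hU : is_class_representatives U) :
  clique_number (reduced_graph U) = sigma n.
Proof.
have cardZ : #|[set: 'Z_n]| = n by rewrite cardsT card_ord Zp_cast.
have cycZ : cyclic [set: 'Z_n] by apply/cyclicP; exists Zp1; exact: Zp_cycle.
by rewrite (clique_number_reduced_power cycZ hU) cardZ.
Qed.
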